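(* Let $\mathcal{C}$ be a $d$-uniform clutter with vertex set $X$ and incidence matrix $A$, and suppose there is a partition $X_1,\ldots,X_d$ of $X$ such that $X_i=\{x_{2i-1},x_{2i}\}$ is a minimal vertex cover of $\mathcal{C}$ (with $|X_i|=2$) for all $i=1,\ldots,d$. Then: (a) $\operatorname{rank}(A)\leq d+1$. (b) If $C$ is a minimal vertex cover of $\mathcal{C}$, then $2\leq |C|\leq d$. (c) If $\mathcal{C}$ satisfies the K\''onig property and there is a minimal vertex cover $C$ of $\mathcal{C}$ with $|C|=d\geq 3$, then $\operatorname{rank}(A)=d+1$. (d) If the edge ideal $I=I(\mathcal{C})$ is minimally non-normal and $\mathcal{C}$ satisfies the packing property, then $\operatorname{rank}(A)=d+1$.
   Context: A clutter $\mathcal{C}$ with finite vertex set $X=\{x_1,\ldots,x_n\}$ is a family of subsets of $X$ (called edges), none of which is included in another. Standing assumption: $\mathcal{C}$ has no isolated vertices, i.e., each vertex lies in at least one edge. $\mathcal{C}$ is $d$-uniform if every edge has exactly $d$ vertices. If $f_1,\ldots,f_q$ are the edges, the incidence matrix $A$ is the $n\times q$ matrix whose columns are $v_k=\sum_{x_i\in f_k}e_i\in\{0,1\}^n$. A minimal vertex cover is a subset of $X$ meeting every edge and minimal under inclusion with this property; $\alpha_0(\mathcal{C})$ is the smallest cardinality of a minimal vertex cover, and $\beta_1(\mathcal{C})$ is the maximum number of pairwise disjoint edges. The edge ideal of $\mathcal{C}$ is $I=I(\mathcal{C})=(x^{v_1},\ldots,x^{v_q})\subset R=K[x_1,\ldots,x_n]$,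 $K$ a field; this gives a one-to-one correspondence between clutters and square-free monomial ideals (the edges are the supports of the minimal monomial generators). A minor of $I$ is a proper ideal $I'$ of $R$ obtained from $I$ by setting some (possibly empty) set of variables equal to $0$ and some disjoint (possibly empty) set of variables equal to $1$ in the generators ($I$ itself is considered a minor); a minor of $\mathcal{C}$ is a clutter corresponding to a minor of $I$. $\mathcal{C}$ satisfies the K\''onig property if $\alpha_0(\mathcal{C})=\beta_1(\mathcal{C})$, and satisfies the packing property if all its minors (including $\mathcal{C}$ itself) satisfy the K\''onig property. The ideal $I$ is normal if $\overline{I^i}=I^i$ for all $i\geq 1$, where $\overline{I^i}=(\{x^a\in R \mid \exists\, p\geq 1:\ (x^a)^p\in I^{pi}\})$ is the integral closure of $I^i$. $I$ is minimally non-normal if $I$ is not normal and all its proper minors are normal.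
   Formalization: Part (b) is stated for d ≥ 2 only: for d = 1 it fails, since the clutter with edges {x1}, {x2} has {x1, x2} as its only minimal vertex cover, of size 2 > d; for d = 0 the empty clutter has the empty cover. *)

(* Defs.v *)
From mathcomp Require Import all_boot all_order all_algebra.
From mathcomp Require Import mpoly.

Set Implicit Arguments.
Unset Strict Implicit.
Unset Printing Implicit Defensive.

Import GRing.Theory.

Local Open Scope ring_scope.

Section Clutters.
Variable n : nat.
Implicit Types (C : {set {set 'I_n}}) (S f g : {set 'I_n}).

Definition is_clutter C : Prop :=
  forall f g, f \in C -> g \in C -> f \subset g -> f = g.

Definition no_isolated C : Prop := cover C = [set: 'I_n].

Definition uniform (d : nat) C : Prop := forall f, f \in C -> #|f| = d.

Definition vertex_cover C S : bool := [forall f in C, f :&: S != set0].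

Definition min_vertex_cover C S : bool := minset (vertex_cover C) S.

(* The default value n is never smaller than the size of a vertex cover, so
   it does not affect the minimum as soon as there is a cover at all, that is,
   as soon as the empty set is not an edge. *)
Definition alpha0 C : nat := \big[minn/n]_(S | min_vertex_cover C S) #|S|.

Definition beta1 C : nat :=
  \max_(M : {set {set 'I_n}} | (M \subset C) && trivIset M) #|M|.

Definition konig C : Prop := alpha0 C = beta1 C.

Definition incidence_matrix C : 'M[rat]_(n, #|C|) :=
  \matrix_(i < n, k < #|C|) (i \in (enum_val k : {set 'I_n}))%:R.

End Clutters.

(* Ideals are extensional predicates on the polynomial ring. *)
Section Ideals.
Variable R : comNzRingType.
Implicit Types (G I J : R -> Prop).

Definition ideal_gen G (p : R) : Prop :=
  exists s : seq (R * R),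
    (forall c, c \in s -> G c.2) /\ p = \sum_(c <- s) c.1 * c.2.

Definition ideal_eq I J : Prop := forall p, I p <-> J p.

Definition proper_ideal I : Prop := ~ I 1.

Definition ideal_pow I (k : nat) : R -> Prop :=
  ideal_gen (fun p => exists s : seq R,
    [/\ size s = k, forall q, q \in s -> I q & p = \prod_(q <- s) q]).

End Ideals.

Section EdgeIdeals.
Variables (K : fieldType) (n : nat).
Implicit Types (C : {set {set 'I_n}}) (I J : {mpoly K[n]} -> Prop).
Implicit Types (f U V : {set 'I_n}).

Definition edge_monomial f : {mpoly K[n]} := 'X_[(\sum_(i in f) U_(i))%MM].

Definition edge_ideal C : {mpoly K[n]} -> Prop :=
  ideal_gen (fun p => exists2 f, f \in C & p = edge_monomial f).

(* x_i := 0 for i in U, x_i := 1 for i in V, other variables unchanged. *)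
Definition minor_subst U V : n.-tuple {mpoly K[n]} :=
  [tuple if i \in U then 0 else if i \in V then 1 else 'X_i | i < n].

Definition minor_ideal C U V : {mpoly K[n]} -> Prop :=
  ideal_gen (fun p =>
    exists2 f, f \in C & p = comp_mpoly (minor_subst U V) (edge_monomial f)).

Definition ideal_minor C J : Prop :=
  exists U V : {set 'I_n},
    [/\ [disjoint U & V], ideal_eq J (minor_ideal C U V) & proper_ideal J].

(* All minors are kept on the vertex set 'I_n, just as the minors of I(C) are
   ideals of the same ring; the eliminated vertices become isolated, which
   changes neither alpha0 nor beta1. *)
Definition clutter_minor C C' : Prop :=
  is_clutter C' /\ ideal_minor C (edge_ideal C').

Definition packing C : Prop := forall C', clutter_minor C C' -> konig C'.

(* Integral closure of I^k, for a monomial ideal I. *)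
Definition int_closure_pow I (k : nat) : {mpoly K[n]} -> Prop :=
  ideal_gen (fun q => exists a : 'X_{1..n},
    q = 'X_[a] /\ exists2 p : nat, (1 <= p)%N & ideal_pow I (p * k) (q ^+ p)).

Definition normal_ideal I : Prop :=
  forall k : nat, (1 <= k)%N -> ideal_eq (int_closure_pow I k) (ideal_pow I k).

Definition minimally_non_normal C : Prop :=
  ~ normal_ideal (edge_ideal C) /\
  forall J, ideal_minor C J -> ~ ideal_eq J (edge_ideal C) -> normal_ideal J.

End EdgeIdeals.

(* Main.v *)
(* Every edge is a transversal of the pairs; write p v for the partner of v. The
   left kernel of the incidence matrix meets the span of the d pair indicators
   in dimension d-1, whence (a). If the rank is at most d, some kernel vector z is
   not constant on the pairs, and w v = z v - z (p v) satisfies w (p v) = - w v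
   and sums to 0 over every edge as soon as C has two disjoint edges. For (c), a
   transversal minimal vertex cover of size d > 2 forces w = 0. For (d), let E u
   be the intersection of the edges through u. The packing property, applied to
   the minor which contracts E u and deletes its partners, gives two edges
   meeting exactly in E u, and so w sums to 0 over E u. Taking u with w u <> 0
   and E u smallest, E u contains some v <> u with w v <> 0, and E v = E u: the
   vertices u and v lie in the same edges. Normality of the minor contracting v
   then implies normality of I(C), a contradiction. *)
Require Import Defs.
From mathcomp Require Import all_boot all_order all_algebra.
From mathcomp Require Import mpoly.
From mathcomp Require Import zify.

Import GRing.Theory Num.Theory.

Section IdealGen.
Context {R : comNzRingType}.
Implicit Types (G H : R -> Prop) (p q : R).
Local Open Scope ring_scope.

Lemma ideal_gen0 G : ideal_gen G 0.
Proof. by exists [::]; split=> //; rewrite big_nil. Qed.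

Lemma ideal_gen_base G p : G p -> ideal_gen G p.
Proof.
move=> Gp; exists [:: (1, p)]; split=> [c|]; last by rewrite big_seq1 mul1r.
by rewrite inE => /eqP->.
Qed.

Lemma ideal_genD G p q : ideal_gen G p -> ideal_gen G q -> ideal_gen G (p + q).
Proof.
move=> [s [sG ->]] [t [tG ->]]; exists (s ++ t); rewrite big_cat; split=> // c.
by rewrite mem_cat => /orP[/sG|/tG].
Qed.

Lemma ideal_genM G p q : ideal_gen G q -> ideal_gen G (p * q).
Proof.
move=> [s [sG ->]]; exists [seq (p * c.1, c.2) | c <- s]; split=> [c|].
  by case/mapP=> c' /sG Gc' ->.
by rewrite big_map mulr_sumr; apply: eq_bigr => c _; rewrite mulrA.
Qed.

Lemma ideal_gen_sum {T : eqType} G (s : seq T) (F : T -> R) :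
  (forall x, x \in s -> ideal_gen G (F x)) -> ideal_gen G (\sum_(x <- s) F x).
Proof.
move=> sG; rewrite big_seq; apply: big_ind => //; first exact: ideal_gen0.
exact: ideal_genD.
Qed.

Lemma ideal_gen_sub G H :
  (forall p, G p -> ideal_gen H p) -> forall p, ideal_gen G p -> ideal_gen H p.
Proof.
move=> sGH p [s [sG ->]]; apply: ideal_gen_sum => c /sG /sGH.
exact: ideal_genM.
Qed.

End IdealGen.

Section SquarefreeMonomials.
Context {K : fieldType} {n : nat}.
Implicit Types (C D : {set {set 'I_n}}) (f g U V : {set 'I_n}).
Implicit Types (m a : 'X_{1..n}) (p q : {mpoly K[n]}).
Local Open Scope ring_scope.

Lemma mnm_setE f i : (\sum_(j in f) U_(j))%MM i = (i \in f) :> nat.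
Proof.
rewrite mnm_sumE; under eq_bigr do rewrite mnm1E.
case: (boolP (i \in f)) => fi.
  by rewrite (bigD1 i) //= eqxx big1 // => j /andP[_ /negPf->].
by rewrite big1 // => j fj; case: eqP fj fi => // -> ->.
Qed.

(* [x^m] is a multiple of a product of [k] edges of [D]. *)
Definition edge_packed D k m :=
  exists s : seq {set 'I_n},
    [/\ size s = k, {subset s <= D} &
        forall i, (count (fun f => i \in f) s <= m i)%N].

Lemma edge_packedD D k l m a :
  edge_packed D k m -> edge_packed D l a -> edge_packed D (k + l) (m + a)%MM.
Proof.
move=> [s [<- sD sm]] [t [<- tD ta]]; exists (s ++ t); split.
- by rewrite size_cat.
- by move=> f; rewrite mem_cat => /orP[/sD|/tD].
- by move=> i; rewrite count_cat mnmDE leq_add.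
Qed.

Definition supp_packed D k p := {in msupp p, forall m, edge_packed D k m}.

Lemma supp_packed_sum {T : eqType} D k (s : seq T) (F : T -> {mpoly K[n]}) :
  (forall x, x \in s -> supp_packed D k (F x)) ->
  supp_packed D k (\sum_(x <- s) F x).
Proof.
move=> sF; rewrite big_seq; apply: big_ind => //.
- by move=> m; rewrite -mpolyC0 msupp0.
- by move=> p q Dp Dq m /msuppD_le; rewrite mem_cat => /orP[/Dp|/Dq].
Qed.

Lemma supp_packedM D k l p q :
  supp_packed D k p -> supp_packed D l q -> supp_packed D (k + l) (p * q).
Proof.
move=> Dp Dq _ /msuppM_le/allpairsP[[m a] /= [/Dp Dm /Dq Da ->]].
exact: edge_packedD.
Qed.

Lemma supp_packed0 D p : supp_packed D 0 p.
Proof. by move=> m _; exists [::]. Qed.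

Lemma edge_ideal_packed D p : edge_ideal D p -> supp_packed D 1 p.
Proof.
move=> [s [sD ->]]; apply: supp_packed_sum => -[a q] /sD[f fD /= ->].
apply: (@supp_packedM D 0); first exact: supp_packed0.
rewrite /edge_monomial => m; rewrite msuppX inE => /eqP->.
exists [:: f]; split=> //.
  by move=> g; rewrite inE => /eqP->.
by move=> i; rewrite mnm_setE /= addn0.
Qed.

Lemma edge_ideal_powP D k p :
  ideal_pow (edge_ideal D) k p <-> supp_packed D k p.
Proof.
split=> [[s [sI ->]]|Dp].
  apply: supp_packed_sum => -[a q] /sI[t [<- tI /= ->]].
  apply: (@supp_packedM D 0); first exact: supp_packed0.
  elim: t tI => [|r t IHt] tI; first exact: supp_packed0.
  rewrite big_cons; apply: (@supp_packedM D 1).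
    by apply/edge_ideal_packed/tI; rewrite mem_head.
  by apply: IHt => q' tq'; apply: tI; rewrite inE tq' orbT.
rewrite [p]mpolyE; apply: ideal_gen_sum => m /Dp[s [sz_s sD sm]].
pose e := (\sum_(f <- s) \sum_(j in f) U_(j))%MM.
have eE i : e i = count (fun f => i \in f) s.
  rewrite /e mnm_sumE; under eq_bigr do rewrite mnm_setE.
  rewrite -sum1_count [RHS]big_mkcond.
  by apply: eq_bigr => f _; case: (i \in f).
have /submK <- : (e <= m)%MM by apply/mnm_lepP => i; rewrite eE.
rewrite mpolyXD -mul_mpolyC mulrA; apply/ideal_genM/ideal_gen_base.
exists [seq edge_monomial K f | f <- s]; split.
- by rewrite size_map.
- by move=> q /mapP[f /sD fD ->]; apply: ideal_gen_base; exists f.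
- by rewrite big_map mprodXE.
Qed.
Lemma edge_ideal_monomial D f :
  edge_ideal D (edge_monomial K f) -> exists2 g, g \in D & g \subset f.
Proof.
move/edge_ideal_packed/(_ _)=> /(_ (\sum_(i in f) U_(i))%MM).
rewrite /edge_monomial msuppX mem_head => /(_ isT).
case=> [[|g [|? ?]]] [] // _ gD gf.
exists g; first by apply: gD; rewrite mem_head.
apply/subsetP => i gi; have := gf i.
by rewrite mnm_setE /= gi; case: (i \in f).
Qed.

Lemma proper_edge_ideal D : set0 \notin D -> Defs.proper_ideal (@edge_ideal K n D).
Proof.
move=> D0 D1; move: D0; apply/negP; rewrite negbK.
have [|f fD] := @edge_ideal_monomial D set0; last by rewrite subset0 => /eqP<-.
by rewrite /edge_monomial big_set0 mpolyX0.
Qed.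

Lemma edge_monomial_prod f : edge_monomial K f = \prod_(i in f) 'X_i.
Proof. by rewrite mprodXE. Qed.

Lemma edge_monomial_subst U V f :
  comp_mpoly (minor_subst K U V) (edge_monomial K f) =
  if [disjoint f & U] then edge_monomial K (f :\: V) else 0.
Proof.
rewrite !edge_monomial_prod rmorph_prod /=.
under eq_bigr do rewrite comp_mpolyXU -tnth_nth tnth_mktuple.
case: ifPn => [dfU|].
  rewrite [RHS]big_mkcond [LHS]big_mkcond; apply: eq_bigr => i _; rewrite inE.
  case: (boolP (i \in f)) => fi; last by rewrite andbF.
  by rewrite (disjointFr dfU fi) andbT; case: (i \in V).
rewrite -setI_eq0 => /set0Pn[i /setIP[fi Ui]].
by rewrite (bigD1 i) //= Ui mul0r.
Qed.

Lemma minor_idealE C U V :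
  ideal_eq (@edge_ideal K n [set f :\: V | f in C & [disjoint f & U]])
           (minor_ideal C U V).
Proof.
move=> p; split; apply: ideal_gen_sub => {}p [f fC ->].
  case/imsetP: fC => g; rewrite inE => /andP[gC gU] ->.
  by apply: ideal_gen_base; exists g; rewrite // edge_monomial_subst gU.
rewrite edge_monomial_subst; case: ifP => fU; last exact: ideal_gen0.
apply: ideal_gen_base; exists (f :\: V) => //.
by apply/imsetP; exists f; rewrite ?inE ?fC.
Qed.

Lemma normal_edge_ideal C :
  (forall (k p : nat) a, (0 < k)%N -> (0 < p)%N ->
     edge_packed C (p * k) (a *+ p)%MM -> edge_packed C k a) ->
  normal_ideal (@edge_ideal K n C).
Proof.
move=> HC k k_gt0 q; split.
  apply: ideal_gen_sub => {}q [a [-> [p p_gt0 /edge_ideal_powP]]].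
  rewrite mpolyXn => /(_ (a *+ p)%MM); rewrite msuppX mem_head => /(_ isT) Ca.
  apply/edge_ideal_powP => m; rewrite msuppX inE => /eqP->.
  exact: HC Ca.
move=> /edge_ideal_powP Cq; rewrite [q]mpolyE; apply: ideal_gen_sum => m /Cq Cm.
rewrite -mul_mpolyC; apply/ideal_genM/ideal_gen_base.
exists m; split=> //; exists 1%N; rewrite // mul1n expr1.
by apply/edge_ideal_powP => m'; rewrite msuppX inE => /eqP->.
Qed.

Lemma normal_edge_ideal_packed C (k p : nat) a :
  normal_ideal (@edge_ideal K n C) -> (0 < k)%N -> (0 < p)%N ->
  edge_packed C (p * k) (a *+ p)%MM -> edge_packed C k a.
Proof.
move=> nC k_gt0 p_gt0 Ca.
have/edge_ideal_powP/(_ a): ideal_pow (@edge_ideal K n C) k 'X_[a].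
  apply/(nC k k_gt0); apply: ideal_gen_base; exists a; split=> //; exists p => //.
  by apply/edge_ideal_powP; rewrite mpolyXn => m; rewrite msuppX inE => /eqP->.
by rewrite msuppX mem_head; apply.
Qed.

(* Lowering the exponent of [u] to that of [w] costs nothing, since every
   product of edges has equal exponents in [u] and [w]; afterwards the exponent
   of [u] controls that of [w], which may therefore be forgotten. *)
Lemma normal_twin C u w :
  u != w -> {in C, forall f, (u \in f) = (w \in f)} ->
  normal_ideal (@edge_ideal K n [set f :\ w | f in C]) ->
  normal_ideal (@edge_ideal K n C).
Proof.
move=> uw twin nD.
apply: normal_edge_ideal => k p a k_gt0 p_gt0 [s [sz_s sC sa]].
pose a' : 'X_{1..n} :=
  [multinom if i == u then minn (a u) (a w) else a i | i < n].
have a'E i : a' i = if i == u then minn (a u) (a w) else a i by rewrite mnmE.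
have counts t : {subset t <= C} ->
    count (fun f => u \in f) t = count (fun f => w \in f) t.
  by move=> tC; apply: eq_in_count => f /tC/twin.
have Da : edge_packed [set f :\ w | f in C] (p * k) (a' *+ p)%MM.
  exists [seq f :\ w | f <- s]; split; first by rewrite size_map.
    by move=> f /mapP[g /sC gC ->]; apply: imset_f.
  move=> i; rewrite count_map mulmnE a'E.
  apply: (@leq_trans (count (fun f => i \in f) s)).
    by apply: sub_count => f /=; rewrite !inE => /andP[].
  case: eqP => [->|_]; last by rewrite -mulmnE.
  by rewrite minnMl leq_min -!mulmnE sa counts // sa.
have [t [sz_t tD ta]] := normal_edge_ideal_packed _ _ _ _ nD k_gt0 p_gt0 Da.
have [r rC tE] : exists2 r : seq {set 'I_n},
    {subset r <= C} & t = [seq f :\ w | f <- r].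
  elim: t tD {sz_t ta} => [|f t IHt] tD; first by exists [::].
  have [g gC fE] := imsetP (tD f (mem_head _ _)).
  have [|r rC ->] := IHt; first by move=> h th; apply: tD; rewrite inE th orbT.
  exists (g :: r); last by rewrite fE.
  by move=> h; rewrite inE => /orP[/eqP->|/rC].
exists r; split=> //; first by rewrite -sz_t tE size_map.
have tcount i : i != w -> (count (fun f => i \in f) r <= a' i)%N.
  move=> iw; apply: leq_trans (ta i); rewrite tE count_map.
  by apply: sub_count => f /= fi; rewrite !inE iw.
move=> i; case: (eqVneq i w) => [->|/tcount/leq_trans->//].
  rewrite -counts //; apply: leq_trans (tcount u uw) _.
  by rewrite a'E eqxx geq_minr.
by rewrite a'E; case: eqP => // ->; rewrite geq_minl.
Qed.

Lemma minimally_non_normal_twinless C u w :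
  is_clutter C -> no_isolated C -> set0 \notin C ->
  minimally_non_normal K C -> {in C, forall f, (u \in f) = (w \in f)} -> u = w.
Proof.
move=> clC noC C1 [nnC minC] twin; apply/eqP/negPn/negP => uw; apply: nnC.
have ED : [set f :\: [set w] | f in C & [disjoint f & set0]] =
          [set f :\ w | f in C].
  have d0 (f : {set 'I_n}) : [disjoint f & set0].
    by rewrite disjoints_subset setC0 subsetT.
  by apply/setP => h; apply/imsetP/imsetP => -[f fC ->]; exists f => //;
    move: fC; rewrite inE d0 andbT.
apply: (normal_twin _ _ _ uw twin); apply: minC.
  exists set0, [set w]; split.
  - by rewrite disjoint_sym disjoints_subset setC0 subsetT.
  - by rewrite -ED; apply: minor_idealE.
  - apply: proper_edge_ideal; apply/imsetP => -[f fC /esym/eqP].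
    rewrite setD_eq0 => /subsetP fw; have [f0|[v fv]] := set_0Vmem f.
      by move: C1; rewrite -f0 fC.
    have /set1P vw := fw _ fv; have := fw u.
    by rewrite twin // -vw fv inE vw (negPf uw) => /(_ isT).
move=> /(_ (edge_monomial K _)) eqI.
have /bigcupP[f fC wf] : w \in cover C by rewrite noC inE.
have [|g gC gf] := @edge_ideal_monomial C (f :\ w).
  by apply/eqI/ideal_gen_base; exists (f :\ w) => //; apply: imset_f.
have gfE : g = f by apply: clC => //; apply: subset_trans gf (subD1set _ _).
by move/subsetP: gf => /(_ w); rewrite gfE wf !inE eqxx => /(_ isT).
Qed.

End SquarefreeMonomials.

Section Polarity.
Context {n : nat}.
Implicit Types (C : {set {set 'I_n}}) (A f g : {set 'I_n}) (u v : 'I_n).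

Definition hull C A := \bigcap_(f in C | A \subset f) f.

Lemma hull_sub C A f : f \in C -> A \subset f -> hull C A \subset f.
Proof. by move=> fC Af; apply: bigcap_inf; rewrite fC. Qed.

Lemma sub_hull C A : A \subset hull C A.
Proof. by apply/bigcapsP => f /andP[]. Qed.

Lemma konig_disjoint C f0 :
  1 < n -> f0 \in C -> konig C -> (forall v, exists2 f, f \in C & v \notin f) ->
  exists f g, [/\ f \in C, g \in C, f != g & f :&: g = set0].
Proof.
move=> n_gt1 f0C konigC no_common.
have: 1 < beta1 C.
  rewrite -konigC /alpha0; apply: (big_ind (fun k => 1 < k)) => //
    [x y|S /minsetP[]].
    by rewrite leq_min => -> ->.
  move=> /forall_inP SC _; rewrite ltn_neqAle eq_sym card_gt0.
  apply/andP; split; last first.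
    by have := SC _ f0C; apply: contraNneq => ->; rewrite setI0.
  apply/cards1P => -[v Sv]; have [f fC vf] := no_common v.
  have /set0Pn[u] := SC _ fC; rewrite Sv !inE => /andP[+ /eqP uv].
  by rewrite uv (negPf vf).
rewrite ltnNge => /negP beta_gt1.
have [M /andP[MC trivM] M_gt1] :
    exists2 M : {set {set 'I_n}}, (M \subset C) && trivIset M & 1 < #|M|.
  apply/exists_inP; rewrite -[X in is_true X]negbK negb_exists_in; apply/negP.
  move=> /forall_inP noM; apply: beta_gt1; apply/bigmax_leqP => M PM.
  by rewrite leqNgt noM.
have /card_gt1P[f [g [fM gM fg]]] := M_gt1.
exists f, g; split=> //; first exact: (subsetP MC); first exact: (subsetP MC).
by apply/eqP; rewrite setI_eq0; move/trivIsetP: trivM; apply.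
Qed.

Section Transversals.
Context {C : {set {set 'I_n}}} {p : 'I_n -> 'I_n}.
Hypothesis pK : involutive p.
Hypothesis pC : {in C, forall f v, (p v \in f) = (v \notin f)}.

(* Contracting the hull of [A] and deleting its partners leaves the edges through
   [A] without their common part; as these have no common vertex, the packing
   property provides two disjoint ones. *)
Lemma packing_hull (K : fieldType) A f0 :
  1 < n -> is_clutter C -> packing K C -> f0 \in C -> A \subset f0 ->
  exists f g, [/\ f \in C, g \in C & f :&: g = hull C A].
Proof.
move=> n_gt1 clC packC f0C Af0; set E := hull C A.
case: (boolP (E \in C)) => [EC|EnC]; first by exists E, E; rewrite setIid.
have AE f : E \subset f -> A \subset f by apply: subset_trans (sub_hull _ _).
have Ef f : f \in C -> [disjoint f & p @: E] = (E \subset f).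
  move=> fC; apply/idP/subsetP => [dfE v Ev|Ef].
    by have := disjointFl dfE (imset_f p Ev); rewrite pC // => /negbFE.
  rewrite disjoint_sym disjoints_subset; apply/subsetP => _ /imsetP[v /Ef vf ->].
  by rewrite inE pC // vf.
pose D := [set f :\: E | f in C & [disjoint f & p @: E]].
have DP h : reflect (exists2 f, f \in C & E \subset f /\ h = f :\: E) (h \in D).
  apply: (iffP imsetP) => [[f + ->]|[f fC [EsubF ->]]].
    by rewrite inE => /andP[fC]; rewrite Ef //; exists f.
  by exists f; rewrite // inE fC Ef.
have subD f g : E \subset g -> f :\: E \subset g :\: E -> f \subset g.
  by move=> Eg; rewrite subDset -{1}(setIidPr Eg) setID.
have konigD : konig D.
  apply: packC; split.
    move=> _ _ /DP[f fC [_ ->]] /DP[g gC [Eg ->]] /(subD _ _ Eg) fg.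
    by rewrite (clC _ _ fC gC fg).
  exists (p @: E), E; split; last 1 first.
  - apply: proper_edge_ideal; apply/negP => /DP[f fC [EsubF /esym/eqP]].
    rewrite setD_eq0 => fE; move: EnC; apply/negP; rewrite negbK.
    by rewrite (_ : E = f) //; apply/eqP; rewrite eqEsubset EsubF.
  - rewrite disjoint_sym; apply: disjointWl (hull_sub _ _ _ f0C Af0) _.
    by rewrite Ef // hull_sub.
  - exact: minor_idealE.
have [||f [g [/DP[h hC [Eh ->]] /DP[k kC [Ek ->]] _ hk]]] :=
    konig_disjoint D (f0 :\: E) n_gt1 _ konigD.
- by apply/DP; exists f0; rewrite // hull_sub.
- move=> v; case: (boolP (v \in E)) => [Ev|].
    exists (f0 :\: E); last by rewrite inE Ev.
    by apply/DP; exists f0; rewrite // hull_sub.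
  move=> /bigcapP vE; have [f /andP[fC Af] vf] :
      exists2 f, (f \in C) && (A \subset f) & v \notin f.
    apply/exists_inP; apply: contraT; rewrite negb_exists_in => /forall_inP H.
    by case: vE => f /H; rewrite negbK.
  exists (f :\: E); last by rewrite inE (negPf vf) andbF.
  by apply/DP; exists f; rewrite // hull_sub.
exists h, k; split=> //; apply/eqP; rewrite eqEsubset subsetI Eh Ek !andbT.
apply/subsetP => v /setIP[hv kv]; apply: contraT => vE.
by move/setP/(_ v): hk; rewrite !inE hv kv vE.
Qed.

Section SignedWeight.
Context {w : 'I_n -> rat}.
Hypothesis w_anti : forall v, w (p v) = (- w v)%R.
Hypothesis w_edge : {in C, forall f, (\sum_(v in f) w v = 0)%R}.
Local Open Scope ring_scope.

Lemma sum_weight_setI f g : f \in C -> g \in C -> \sum_(v in f :&: g) w v = 0.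
Proof.
move=> fC gC.
have fE := w_edge f fC; have gE := w_edge g gC.
rewrite (big_setID g) /= in fE; rewrite (big_setID f) setIC /= in gE.
have diff : \sum_(v in g :\: f) w v = - \sum_(v in f :\: g) w v.
  rewrite (reindex_inj (inv_inj pK)) -sumrN; apply: eq_big => v.
    by rewrite !inE !pC // negbK andbC.
  by rewrite w_anti.
rewrite diff in gE; move: fE; rewrite (subr0_eq gE) => /eqP.
by rewrite -mulr2n mulrn_eq0 => /eqP.
Qed.

End SignedWeight.
End Transversals.

Lemma twin_exists C (w : 'I_n -> rat) u0 :
  (w u0 != 0)%R ->
  (forall u, (\sum_(v in hull C [set u]) w v = 0)%R) ->
  exists u v, u != v /\ {in C, forall f, (u \in f) = (v \in f)}.
Proof.
move=> wu0 hull0.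
case: (@arg_minnP _ u0 (fun u => w u != 0)%R (fun u => #|hull C [set u]|))
  => //= u wu minu.
have hullP x f : f \in C -> x \in f -> hull C [set x] \subset f.
  by move=> fC xf; rewrite hull_sub // sub1set.
have uu x : x \in hull C [set x] by rewrite -sub1set sub_hull.
have /exists_inP[v uv /andP[vu wv]] :
    [exists v in hull C [set u], (v != u) && (w v != 0)%R].
  apply: contraT; rewrite negb_exists_in => /forall_inP noV; case/eqP: wu.
  rewrite -(hull0 u) (bigD1 u) //= big1 ?addr0 // => v /andP[uv vu].
  by have := noV v uv; rewrite vu negbK => /eqP.
have vuE : hull C [set v] = hull C [set u].
  apply/eqP; rewrite eqEcard minu // andbT; apply/bigcapsP => f /andP[fC].
  rewrite sub1set => uf; have vf := subsetP (hullP u f fC uf) v uv.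
  exact: hullP.
exists u, v; rewrite eq_sym; split=> // f fC; apply/idP/idP => xf.
  exact: (subsetP (hullP u f fC xf)).
by apply: (subsetP (hullP v f fC xf)); rewrite vuE.
Qed.

End Polarity.

Section PairPartition.
Context {n d : nat} {C P : {set {set 'I_n}}}.
Hypotheses (unifC : uniform d C) (partP : partition P [set: 'I_n]).
Hypothesis cardP : #|P| = d.
Hypothesis pairP : forall Y, Y \in P -> #|Y| = 2.
Hypothesis coverP : forall Y, Y \in P -> vertex_cover C Y.
Implicit Types (f Y S : {set 'I_n}) (u v : 'I_n).

Lemma card_ground : n = d.*2.
Proof.
have := card_partition partP; rewrite cardsT card_ord => ->.
by rewrite -muln2 -cardP -sum_nat_const; apply: eq_bigr.
Qed.

(* The [d] pairs partition the [d] vertices of [f] and each contains at least one. *)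
Lemma card_pair_edge f Y : f \in C -> Y \in P -> \sum_(v in Y) (v \in f) = 1.
Proof.
move=> fC YP.
have fY Z : Z \in P -> 0 < \sum_(v in Z) (v \in f).
  move=> /coverP/forall_inP/(_ f fC)/set0Pn[v /setIP[vf vZ]].
  by rewrite (bigD1 v) //= vf.
apply/eqP; rewrite eqn_leq fY // andbT.
have: \sum_(v in [set: 'I_n]) (v \in f) = d.
  rewrite -(unifC f fC) -sum1_card [RHS]big_mkcond [LHS]big_mkcond.
  by apply: eq_bigr => v _; rewrite inE; case: (v \in f).
rewrite (set_partition_big _ partP) /= (bigD1 Y) //= => sumE.
have: #|P :\ Y| <= \sum_(Z in P | Z != Y) \sum_(v in Z) (v \in f).
  rewrite -sum1_card; under eq_bigl do rewrite !inE andbC.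
  by apply: leq_sum => Z /andP[ZP _]; apply: fY.
have := cardsD1 Y P; rewrite YP cardP => dE le_rest.
by rewrite -(leq_add2r #|P :\ Y|) -dE -sumE leq_add2l.
Qed.

Lemma partner_exists :
  exists p : 'I_n -> 'I_n,
    [/\ involutive p, forall v, p v != v, forall v, pblock P v = [set v; p v] &
        {in C, forall f v, (p v \in f) = (v \notin f)}].
Proof.
have [/eqP covP trivP _] := and3P partP.
have vP v : v \in cover P by rewrite covP inE.
have blockP v : exists u, pblock P v = [set v; u] /\ u != v.
  have /eqP/cards2P[x [y [xy YE]]] := pairP _ (pblock_mem (vP v)).
  have := vP v; rewrite -mem_pblock YE => /set2P[->|->].
    by exists y; rewrite eq_sym.
  by exists x; rewrite setUC.
have [p pP] := fin_all_exists blockP.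
have pv v : p v != v by have [] := pP v.
have pE v : pblock P v = [set v; p v] by have [] := pP v.
exists p; split=> // [v|f fC v].
  have : pblock P (p v) = pblock P v.
    by apply: same_pblock => //; rewrite pE !inE eqxx orbT.
  rewrite !pE => /setP/(_ v); rewrite !inE eqxx (eq_sym v) (negPf (pv v)) /=.
  move=> ppv.
  by apply/esym/eqP.
have := card_pair_edge _ _ fC (pblock_mem (vP v)).
rewrite pE big_setU1 ?inE 1?eq_sym ?pv //= big_set1.
by case: (v \in f); case: (p v \in f).
Qed.

Local Open Scope ring_scope.

Let pairs : 'M[rat]_(#|P|, n) :=
  \matrix_(i, v) (v \in (enum_val i : {set 'I_n}))%:R.

Let pairs_edges : pairs *m incidence_matrix C = const_mx 1.
Proof.
apply/matrixP => i k; rewrite !mxE.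
transitivity ((\sum_(v in (enum_val i : {set 'I_n}))
                 (v \in (enum_val k : {set 'I_n})))%N%:R : rat).
  rewrite natr_sum [RHS]big_mkcond; apply: eq_bigr => v _; rewrite !mxE.
  by case: ifP; rewrite ?mul1r ?mul0r.
by rewrite card_pair_edge ?enum_valP.
Qed.

Let rank_pairs : \rank pairs = d.
Proof.
rewrite -cardP; apply/eqP/row_freeP.
exists (\matrix_(v, i) ((v \in (enum_val i : {set 'I_n}))%:R / 2)).
apply/matrixP => i j; rewrite !mxE.
transitivity (#|(enum_val i : {set 'I_n}) :&: enum_val j|%:R / 2 : rat).
  rewrite -[#|_ (_ :&: _)|]sum1_card natr_sum mulr_suml [RHS]big_mkcond.
  apply: eq_bigr => v _.
  by rewrite !mxE inE; case: (v \in _); case: (v \in _); rewrite ?mul1r ?mul0r.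
have [_ /trivIsetP trivP _] := and3P partP.
have [<-|ij] := eqVneq i j; first by rewrite setIid pairP ?enum_valP // divff.
have := trivP _ _ (enum_valP i) (enum_valP j).
rewrite (inj_eq enum_val_inj) ij -setI_eq0 => /(_ isT)/eqP->.
by rewrite cards0 mul0r.
Qed.

Let kerA := kermx (incidence_matrix C).

Let rank_kerA : (\rank kerA + \rank (incidence_matrix C))%N = d.*2.
Proof. by rewrite mxrank_ker subnK -?card_ground ?rank_leq_row. Qed.

Lemma rank_incidence_le : (\rank (incidence_matrix C) <= d.+1)%N.
Proof.
have ones_le1 : (\rank (const_mx 1%R : 'M[rat]_(#|P|, #|C|)) <= 1)%N.
  have -> : const_mx 1 = (const_mx 1 : 'cV[rat]_#|P|) *m (const_mx 1 : 'rV_#|C|).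
    by apply/matrixP => i j; rewrite !mxE big_ord1 !mxE mulr1.
  by apply: leq_trans (mxrankM_maxl _ _) (rank_leq_col _).
have := mxrank_mul_ker pairs (incidence_matrix C); rewrite pairs_edges rank_pairs.
have := mxrankS (capmxSr pairs kerA); rewrite -/kerA.
by move: rank_kerA ones_le1; lia.
Qed.

(* If every [z] in the kernel were constant on the pairs, the kernel would be
   the hyperplane of sum 0 in the [d]-dimensional space of such vectors. *)
Lemma low_rank_kernel (p : 'I_n -> 'I_n) :
  (forall v, pblock P v = [set v; p v]) -> (0 < d)%N -> C != set0 ->
  \rank (incidence_matrix C) != d.+1 ->
  exists (z : 'I_n -> rat) (v : 'I_n),
    {in C, forall f, \sum_(u in f) z u = 0} /\ z v != z (p v).
Proof.
move=> pE d_gt0 C0 rankA.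
have : ~~ (kerA <= pairs)%MS.
  apply: contra rankA => /capmx_idPr kerE.
  have := mxrank_mul_ker pairs (incidence_matrix C); rewrite -/kerA kerE.
  rewrite rank_pairs => capE; rewrite eqn_leq rank_incidence_le /=.
  have : (0 < \rank (pairs *m incidence_matrix C))%N.
    rewrite pairs_edges lt0n mxrank_eq0; apply/eqP => /matrixP.
    rewrite -cardP in d_gt0; rewrite -card_gt0 in C0.
    by move/(_ (Ordinal d_gt0) (Ordinal C0)); rewrite !mxE => /eqP; rewrite oner_eq0.
  move: capE rank_kerA.
  move: (\rank kerA) (\rank (pairs *m _)) (\rank (incidence_matrix C)) => a b c.
  clear; lia.
case/row_subPn => i zP; pose z := row i kerA.
have zA : z *m incidence_matrix C = 0 by rewrite -row_mul mulmx_ker row0.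
have zC : {in C, forall f, \sum_(u in f) z 0 u = 0}.
  move=> f fC; move/rowP/(_ (enum_rank_in fC f)): zA; rewrite !mxE => {2}<-.
  rewrite [LHS]big_mkcond; apply: eq_bigr => v _; rewrite !mxE enum_rankK_in //.
  by case: ifP; rewrite ?mulr1 ?mulr0.
rewrite -/z in zP; clearbody z; exists (z 0).
case: (pickP (fun v => z 0 v != z 0 (p v))) => [v zv|noV]; first by exists v.
case/negP: zP.
pose c : 'rV[rat]_#|P| :=
  \row_j if [pick v in (enum_val j : {set 'I_n})] is Some v then z 0 v else 0.
apply/submxP; exists c; apply/rowP => v; rewrite mxE.
have [/eqP covP trivP _] := and3P partP.
have vP : pblock P v \in P by rewrite pblock_mem // covP inE.
have jE := enum_rankK_in vP vP; set j := enum_rank_in vP _ in jE.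
rewrite (bigD1 j) //= big1 ?addr0 => [|k kj]; last first.
  rewrite !mxE; case: (boolP (v \in _)) => [vk|_]; last by rewrite mulr0.
  case/eqP: kj; apply: enum_val_inj; rewrite jE.
  by rewrite (def_pblock trivP (enum_valP k) vk).
rewrite !mxE jE mem_pblock covP inE mulr1; case: pickP => [u|/(_ v)].
  by rewrite pE => /set2P[->|->] //; apply/eqP; have /negbT := noV v; rewrite negbK.
by rewrite mem_pblock covP inE.
Qed.

End PairPartition.

Section SignedWeights.
Context {n : nat} {C : {set {set 'I_n}}} {p : 'I_n -> 'I_n}.
Implicit Types (f g S : {set 'I_n}) (u v : 'I_n).
Hypothesis pK : involutive p.
Hypothesis pC : {in C, forall f v, (p v \in f) = (v \notin f)}.

Lemma signed_weight_of_kernel f0 g0 (z : 'I_n -> rat) :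
  f0 \in C -> g0 \in C -> f0 :&: g0 = set0 ->
  {in C, forall f, (\sum_(v in f) z v = 0)%R} ->
  {in C, forall f, (\sum_(v in f) (z v - z (p v)) = 0)%R}.
Proof.
move=> f0C g0C fg0 zC f fC.
have pE h (hC : h \in C) : (\sum_(v in h) z (p v) = \sum_(v in ~: h) z v)%R.
  by rewrite [RHS](reindex_inj (inv_inj pK)); apply: eq_bigl => v; rewrite inE pC ?negbK.
have g0E : g0 = ~: f0.
  apply/setP => v; rewrite inE; apply/idP/idP => [vg|vf].
    by apply: contraTN vg => vf; move/setP/(_ v): fg0; rewrite !inE vf => /negbT.
  rewrite -[v \in g0]negbK -pC //; apply/negP => pvg.
  by move/setP/(_ (p v)): fg0; rewrite !inE pvg pC ?vf.
have total h : h \in C -> (\sum_(v in h) z v + \sum_(v in ~: h) z v = \sum_v z v)%R.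
  move=> _; rewrite [RHS](bigID (mem h)) /=; congr (_ + _)%R.
  by apply: eq_bigl => v; rewrite inE.
rewrite sumrB pE //; have := total _ fC.
rewrite -(total _ f0C) -g0E (zC f) ?(zC f0) ?(zC g0) // !add0r => ->.
by rewrite oppr0.
Qed.

(* Minimality of [S] yields, for each [u] in [S], an edge meeting [S] in [u] only:
   it consists of [u] and the partners of [S :\ u]. Hence [2 * w u] is the sum of
   [w] over [S], for all [u] in [S]. *)
Lemma signed_weight_transversal_cover S (w : 'I_n -> rat) :
  min_vertex_cover C S -> (forall v, (p v \in S) = (v \notin S)) -> #|S| != 2 ->
  (forall v, w (p v) = - w v)%R -> {in C, forall f, (\sum_(v in f) w v = 0)%R} ->
  forall v, w v = 0%R.
Proof.
move=> /minsetP[Scov Smin] pS S2 w_anti w_edge.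
pose s := (\sum_(v in S) w v)%R.
have w2 u : u \in S -> (w u *+ 2 = s)%R.
  move=> uS; have [f fC fS] : exists2 f, f \in C & f :&: S = [set u].
    have nocov : ~~ vertex_cover C (S :\ u).
      apply/negP => /Smin/(_ (subD1set _ _)) SE.
      by move: uS; rewrite -SE !inE eqxx.
    have [f fC] : exists2 f, f \in C & ~~ (f :&: (S :\ u) != set0).
      by apply/exists_inP; rewrite -negb_forall_in.
    rewrite negbK => /eqP fSu; exists f => //.
    move/forall_inP/(_ f fC)/set0Pn: Scov => [x /setIP[xf xS]].
    have in_fS v : v \in f -> v \in S -> v = u.
      move=> vf vS; apply/eqP; apply: contraT => vu.
      by move/setP/(_ v): fSu; rewrite !inE vf vS vu.
    apply/setP => v; rewrite !inE; apply/andP/eqP => [[]|->]; first exact: in_fS.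
    by split; rewrite // -(in_fS x).
  have uf : u \in f by have := set11 u; rewrite -fS => /setIP[].
  have fE v : (v \in f) && (v != u) = (p v \in S :\ u).
    have fSv : (v \in f) && (v \in S) = (v == u).
      by have /setP/(_ v) := fS; rewrite !inE.
    have pfSv : (p v \in f) && (p v \in S) = (p v == u).
      by have /setP/(_ (p v)) := fS; rewrite !inE.
    move: fSv pfSv; rewrite !inE pC // pS.
    by case: (v \in f); case: (v \in S); case: (v == u); case: (p v == u).
  have := w_edge f fC; rewrite (bigD1 u) //= (eq_bigl _ _ fE).
  rewrite (reindex_inj (inv_inj pK)) /=.
  under eq_bigl do rewrite pK; under eq_bigr do rewrite w_anti.
  rewrite sumrN => /subr0_eq wE; rewrite /s (bigD1 u) //= mulr2n {2}wE.
  by congr (_ + _)%R; apply: eq_bigl => v; rewrite !inE andbC.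
have s0 : s = 0%R.
  have sS : (s *+ 2 = s *+ #|S|)%R.
    by rewrite {1}/s -sumrMnl -sumr_const; apply: eq_bigr.
  apply/eqP; have /eqP := sS; rewrite -!(mulr_natr s) -subr_eq0 -mulrBr mulf_eq0.
  by rewrite subr_eq0 eqr_nat (eq_sym 2) (negPf S2) orbF.
have wS u : u \in S -> w u = 0%R.
  by move/w2/eqP; rewrite s0 mulrn_eq0 => /eqP.
move=> v; case: (boolP (v \in S)) => [/wS//|].
by rewrite -pS => /wS/eqP; rewrite w_anti oppr_eq0 => /eqP.
Qed.

End SignedWeights.

Theorem theorem4p4 (K : fieldType) (n d : nat)
    (C : {set {set 'I_n}}) (P : {set {set 'I_n}})
    (clutterC : is_clutter C) (noisoC : no_isolated C) (unifC : uniform d C)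
    (partP : partition P [set: 'I_n]) (cardP : #|P| = d)
    (coverP : forall Y : {set 'I_n}, Y \in P ->
       #|Y| = 2 /\ min_vertex_cover C Y) :
  [/\ (* (a) *)
      \rank (incidence_matrix C) <= d.+1,
      (* (b); for d = 1 the clutter {{x1}, {x2}} has {x1, x2} as its only
         minimal vertex cover, so the upper bound needs d >= 2 *)
      2 <= d -> forall S : {set 'I_n}, min_vertex_cover C S -> 2 <= #|S| <= d,
      (* (c) *)
      konig C ->
        (exists S : {set 'I_n}, [/\ min_vertex_cover C S, #|S| = d & 3 <= d]) ->
        \rank (incidence_matrix C) = d.+1
    & (* (d) *)
      minimally_non_normal K C -> packing K C ->
        \rank (incidence_matrix C) = d.+1].
Proof.
have pairP Y : Y \in P -> #|Y| = 2 by case/coverP.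
have vcP Y : Y \in P -> vertex_cover C Y by case/coverP => _ /minsetP[].
have nE := card_ground partP cardP pairP.
have [p [pK p_neq pE pC]] := partner_exists unifC partP cardP pairP vcP.
have edge_at v : exists2 f, f \in C & v \in f.
  by have : v \in cover C; [rewrite noisoC inE | case/bigcupP => f; exists f].
have no_common v : exists2 f, f \in C & v \notin f.
  by have [f fC pvf] := edge_at (p v); exists f; rewrite // -pC.
have card_pv v : #|[set v; p v]| = 2 by rewrite cards2 eq_sym p_neq.
have pairing v : [set v; p v] \in P.
  by rewrite -pE pblock_mem //; have [/eqP-> _ _] := and3P partP; rewrite inE.
have posP : 0 < d -> 1 < n /\ exists f0, f0 \in C.
  move=> d_gt0; have n_gt1 : 1 < n.
    by rewrite nE -addnn; case: (d) d_gt0 => // k _; rewrite addnS.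
  by split=> //; have [f0] := edge_at (Ordinal (ltnW n_gt1)); exists f0.
have cardUp (S : {set 'I_n}) : (forall v, ~~ ((v \in S) && (p v \in S))) ->
      #|S :|: p @: S| = #|S|.*2.
  move=> nopair; have disj : [disjoint S & p @: S].
    rewrite disjoints_subset; apply/subsetP => v vS; rewrite inE.
    apply/negP => /imsetP[u uS vE]; have := nopair u.
    by rewrite uS -vE vS.
  rewrite cardsU disjoint_setI0 // cards0 subn0 (card_imset _ (inv_inj pK)).
  by rewrite addnn.
have coverS S : min_vertex_cover C S ->
    #|S| = 2 \/ forall v, ~~ ((v \in S) && (p v \in S)).
  move=> /minsetP[Scov Smin].
  case: (boolP [exists v, (v \in S) && (p v \in S)]).
    case/existsP=> v /andP[vS pvS].
    left; rewrite -(card_pv v); congr #|pred_of_set _|; apply/esym/Smin.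
      exact/vcP/pairing.
    by rewrite subUset !sub1set vS.
  by rewrite negb_exists => /forallP; right.
have kernel : \rank (incidence_matrix C) != d.+1 -> 0 < d ->
    (exists f g, [/\ f \in C, g \in C & f :&: g = set0]) ->
    exists (w : 'I_n -> rat) v, [/\ w v != 0%R, forall u, (w (p u) = - w u)%R &
      {in C, forall f : {set 'I_n}, (\sum_(u in f) w u = 0)%R}].
  move=> rankC d_gt0 [f [g [fC gC fg]]].
  have C0 : C != set0 by apply/set0Pn; exists f.
  have [z [v [zC zv]]] :=
    low_rank_kernel unifC partP cardP pairP vcP _ pE d_gt0 C0 rankC.
  exists (fun u => z u - z (p u))%R, v; split; first by rewrite subr_eq0.
    by move=> u; rewrite pK opprB.
  exact: (signed_weight_of_kernel pK pC f g).
split.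
- exact: rank_incidence_le unifC partP cardP pairP vcP.
- move=> d_ge2 S minS; have [_ [f0 f0C]] := posP (ltnW d_ge2).
  apply/andP; split; last first.
    have [->//|/cardUp dblS] := coverS S minS.
    by rewrite -leq_double -dblS -nE -[n in _ <= n]card_ord max_card.
  rewrite ltn_neqAle eq_sym card_gt0; have /minsetP[/forall_inP Scov _] := minS.
  apply/andP; split; last first.
    by have := Scov _ f0C; apply: contraNneq => ->; rewrite setI0.
  apply/cards1P => -[v Sv]; have [f fC vf] := no_common v.
  have := Scov f fC; rewrite Sv setIC.
  by rewrite setI_eq0 disjoints_subset sub1set inE vf.
- move=> konigC [S [minS Sd d_ge3]]; apply/eqP; apply: contraT => rankC.
  have d_gt0 : 0 < d by apply: leq_trans d_ge3.
  have S2 : #|S| != 2 by rewrite Sd; case: (d) d_ge3 => [|[|[|]]].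
  have [n_gt1 [f0 f0C]] := posP d_gt0.
  have [f [g [fC gC _ fg]]] := konig_disjoint C f0 n_gt1 f0C konigC no_common.
  have [|w [v [wv w_anti w_edge]]] := kernel rankC d_gt0; first by exists f, g.
  case/eqP: wv; apply: (signed_weight_transversal_cover pK pC S) => // u.
  case: (coverS S minS) => [/eqP|nopair]; first by rewrite (negPf S2).
  have /setP/(_ u) : S :|: p @: S = setT.
    by apply/eqP; rewrite eqEcard subsetT cardUp // cardsT card_ord Sd -nE leqnn.
  have -> : (u \in S :|: p @: S) = (u \in S) || (p u \in S).
    by rewrite inE -{2}[u]pK (mem_imset _ _ (inv_inj pK)).
  rewrite inE; have := nopair u.
  by case: (u \in S); case: (p u \in S).
- move=> mnnC packC; apply/eqP; apply: contraT => rankC.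
  have [d0|d_gt0] := posnP d.
    case: mnnC => nnC _; case: nnC; apply: normal_edge_ideal => k q a k_gt0 q_gt0.
    case=> s [sz_s sC _]; have qk_gt0 : 0 < q * k by rewrite muln_gt0 q_gt0.
    case: s sz_s sC => [sz_s|f s _ sC]; first by rewrite -sz_s in qk_gt0.
    exists (nseq k f); split; first by rewrite size_nseq.
      by move=> g /nseqP[-> _]; apply: sC; rewrite mem_head.
    by move=> i; have := ltn_ord i; rewrite {2}nE d0.
  have [n_gt1 [f0 f0C]] := posP d_gt0.
  have hull0 : hull C set0 = set0.
    apply/setP => v; rewrite inE; apply/negP => /bigcapP vC.
    by have [f fC /negP[]] := no_common v; apply: vC; rewrite fC sub0set.
  have packing_hullC A f := packing_hull pC K A f n_gt1 clutterC packC.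
  have [|w [u0 [wu0 w_anti w_edge]]] := kernel rankC d_gt0.
    have [f [g [fC gC fg]]] := packing_hullC _ _ f0C (sub0set _).
    by exists f, g; rewrite fg hull0.
  have [|u [v [uv twin]]] := twin_exists C w u0 wu0.
    move=> u; have [f fC uf] := edge_at u.
    have [|g [h [gC hC <-]]] := packing_hullC [set u] f fC.
      by rewrite sub1set.
    exact: (sum_weight_setI pK pC w_anti w_edge).
  case/eqP: uv.
  apply: (minimally_non_normal_twinless _ _ _ clutterC noisoC _ mnnC twin).
  by apply/negP => /unifC d0; move: d_gt0; rewrite -d0 cards0.
Qed.
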